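(* Let $r\ge1$ and let $\lambda=(\lambda_1,\ldots,\lambda_r)$ be a Ferrers shape with $r$ rows, i.e. integers $\lambda_1\ge\cdots\ge\lambda_r\ge 0$. The boolean number of the Ferrers graph associated to $\lambda$ is $$\beta(\lambda)=\sum_{j=0}^{r}c_\lambda(r,j)\cdot j^{\lambda_r},$$ with the convention $0^0=1$.
   Context: Boolean number: for a finite simple graph $G$, the integer $\beta(G)$ is the (well-defined, isomorphism-invariant) quantity determined recursively by $\beta(\emptyset)=1$ for the empty graph, $\beta(\delta_n)=0$ where $\delta_n$ ($n\ge1$) is the graph of $n$ isolated vertices, and, for any edge $e$ of $G$, $\beta(G)=\beta(G-e)+\beta(G/e)+\beta(G-[e])$. Here $G-e$ deletes the edge $e$; $G/e$ contracts $e$ and then removes loops and redundant (parallel) edges; $G-[e]$ removes $e$ together with both its end vertices (and all edges incident to them). It is known that the recursion is independent of choices, and that $\beta(G)$ is the number of spheres of dimension $|G|-1$ in the wedge of spheres to which the boolean complex of $G$ is homotopy equivalent (the boolean complex being the regular cell complex of the simplicial poset of words in distinct vertices of $G$, ordered by substring inclusion, modulo commuting letters that are non-adjacent in $G$). Ferrers graph: a Ferrers shape with $r$ rows is a sequence $\lambda=(\lambda_1,\ldots,\lambda_r)$ of integers with $\lambda_1\ge\cdots\ge\lambda_r\ge0$ (rows may be empty). Its Ferrers graph has vertex set $\{x_1,\ldots,x_r\}\sqcup\{y_1,\ldots,y_{\lambda_1}\}$ and an edge $\{x_i,y_j\}$ exactly when $\lambda_i\ge j$. Write $\beta(\lambda)$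 for the boolean number of this graph. Coefficients: for $1\le i\le r$ and $j\in\mathbb{Z}$, define $c_\lambda(1,0)=-1$, $c_\lambda(1,1)=1$, $c_\lambda(1,j)=0$ for $j\notin\{0,1\}$, and for $1<i\le r$ $$c_\lambda(i,j)=j(j-1)^{\lambda_{i-1}-\lambda_i}\,c_\lambda(i-1,j-1)-(j+1)j^{\lambda_{i-1}-\lambda_i}\,c_\lambda(i-1,j),$$ with the convention $0^0=1$. *)

(* Defs.v *)
From mathcomp Require Import all_boot all_order all_algebra.

Set Implicit Arguments.
Unset Strict Implicit.
Unset Printing Implicit Defensive.

Import GRing.Theory.

Local Open Scope ring_scope.

Record sgraph := SGraph {
  vertex :> finType;
  adj : rel vertex;
  adj_sym : symmetric adj;
  adj_irr : irreflexive adj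
}.

Definition del_edge_adj (G : sgraph) (u v : G) : rel G :=
  fun x y => adj x y && ([set x; y] != [set u; v]).

Lemma del_edge_sym (G : sgraph) (u v : G) : symmetric (del_edge_adj u v).
Proof. by move=> x y; rewrite /del_edge_adj adj_sym setUC. Qed.

Lemma del_edge_irr (G : sgraph) (u v : G) : irreflexive (del_edge_adj u v).
Proof. by move=> x; rewrite /del_edge_adj adj_irr. Qed.

Definition del_edge (G : sgraph) (u v : G) : sgraph :=
  SGraph (del_edge_sym u v) (del_edge_irr u v).

(* The vertex obtained by merging u and v is represented by u, so the vertices
   of the contraction are those of G other than v.  The test x != y removes the
   loop; parallel edges are merged since adjacency is a relation. *)
Definition contract_adj (G : sgraph) (u v : G) : rel {x : G | x != v} :=
  fun x y => [&& x != y & [|| adj (val x) (val y),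
                             (val x == u) && adj v (val y)
                           | (val y == u) && adj (val x) v]].

Lemma contract_sym (G : sgraph) (u v : G) : symmetric (@contract_adj G u v).
Proof.
move=> x y; rewrite /contract_adj eq_sym [adj (val x) (val y)]adj_sym.
by rewrite [adj v (val y)]adj_sym [adj (val x) v]adj_sym [X in _ || X]orbC.
Qed.

Lemma contract_irr (G : sgraph) (u v : G) : irreflexive (@contract_adj G u v).
Proof. by move=> x; rewrite /contract_adj eqxx. Qed.

Definition contract (G : sgraph) (u v : G) : sgraph :=
  SGraph (@contract_sym G u v) (@contract_irr G u v).

Definition del_ends_adj (G : sgraph) (u v : G) :
    rel {x : G | (x != u) && (x != v)} :=
  fun x y => adj (val x) (val y).

Lemma del_ends_sym (G : sgraph) (u v : G) : symmetric (@del_ends_adj G u v).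
Proof. by move=> x y; apply: adj_sym. Qed.

Lemma del_ends_irr (G : sgraph) (u v : G) : irreflexive (@del_ends_adj G u v).
Proof. by move=> x; apply: adj_irr. Qed.

Definition del_ends (G : sgraph) (u v : G) : sgraph :=
  SGraph (@del_ends_sym G u v) (@del_ends_irr G u v).

(* [is_boolean_number G b]: some run of the recursion computes [b] from [G].
   That every graph has exactly one such [b] is proved below. *)
Inductive is_boolean_number : sgraph -> int -> Prop :=
| BN_empty (G : sgraph) :
    #|G| = 0%N -> is_boolean_number G 1
| BN_isolated (G : sgraph) :
    (0 < #|G|)%N -> (forall x y : G, ~~ adj x y) -> is_boolean_number G 0
| BN_edge (G : sgraph) (u v : G) (a b c : int) :
    adj u v ->
    is_boolean_number (del_edge u v) a ->
    is_boolean_number (contract u v) b ->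
    is_boolean_number (del_ends u v) c ->
    is_boolean_number G (a + b + c).

Lemma card_contract (G : sgraph) (u v : G) : (#|contract u v|).+1 = #|G|.
Proof.
rewrite card_sig (cardD1 v G) inE; congr _.+1.
by apply: eq_card => x; rewrite !inE andbT.
Qed.

Lemma card_del_ends (G : sgraph) (u v : G) :
  u != v -> (#|del_ends u v|).+2 = #|G|.
Proof.
move=> uv; rewrite card_sig [RHS](cardD1 v) inE [in RHS](cardD1 u) !inE uv.
by congr _.+2; apply: eq_card => x; rewrite !inE andbT.
Qed.

Lemma adj_neq (G : sgraph) (u v : G) : adj u v -> u != v.
Proof. by move=> uv; apply/eqP => E; rewrite E adj_irr in uv. Qed.

Lemma boolean_number_exists (G : sgraph) : {b : int | is_boolean_number G b}.
Proof.
move: {2}(#|G|).+1 (ltnSn #|G|) => n; elim: n G => [//|n IHn] G.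
pose E (G : sgraph) := [pred p : G * G | adj p.1 p.2].
move: {2}(#|E G|).+1 (ltnSn #|E G|) => m; elim: m G => [//|m IHm] G Gm Gn.
case: (pickP (E G)) => [[u v] /= uv | noE]; last first.
  case: (posnP #|G|) => G0; first by exists 1; apply: BN_empty.
  exists 0; apply: BN_isolated => // x y.
  by have /= := noE (x, y); move=> ->.
have [|//|a Ha] := IHm (del_edge u v).
  rewrite -ltnS; apply: leq_trans Gm; rewrite ltnS.
  apply: proper_card; apply/properP; split.
    by apply/subsetP => p; rewrite !inE => /andP[].
  by exists (u, v); rewrite !inE //= /del_edge_adj eqxx andbF.
have [|b Hb] := IHn (contract u v).
  by rewrite -ltnS card_contract.
have [|c Hc] := IHn (del_ends u v).
  by rewrite -ltnS ltnW // ltnS card_del_ends ?adj_neq.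
by exists (a + b + c); apply: (BN_edge uv).
Qed.

Definition boolean_number (G : sgraph) : int := sval (boolean_number_exists G).

(* Independence of choices: counting maps to q colours and a blank, where
   adjacent vertices never receive the same colour, gives a polynomial in q; up
   to sign, its value at q = -1 is the boolean number. *)

Definition partial_colorings (G : sgraph) (q : nat) :
    {set {ffun G -> option 'I_q}} :=
  [set f : {ffun G -> option 'I_q} |
    [forall x, forall y, adj x y ==> (f x == None) || (f x != f y)]].

Lemma partial_coloringsP (G : sgraph) (q : nat) (f : {ffun G -> option 'I_q}) :
  reflect (forall x y, adj x y -> f x = f y -> f x = None)
          (f \in partial_colorings G q).
Proof.
rewrite inE; apply: (iffP forallP) => [H x y xy fxy | H x].
  have /forallP/(_ y) := H x; rewrite xy fxy eqxx orbF /=.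
  by move/eqP.
apply/forallP => y; apply/implyP => xy.
by case: (eqVneq (f x) (f y)) => [/(H _ _ xy) -> //|_]; rewrite orbT.
Qed.

Lemma card_colorings_contract (G : sgraph) (u v : G) (q : nat) : adj u v ->
  #|[set f in partial_colorings (del_edge u v) q | f u == f v]| =
  #|partial_colorings (contract u v) q|.
Proof.
move=> uv; have nuv := adj_neq uv.
pose u' : contract u v := exist _ u nuv.
pose ext (h : {ffun contract u v -> option 'I_q}) : {ffun G -> option 'I_q} :=
  [ffun x => h (insubd u' x)].
have extV h (x : contract u v) : ext h (val x) = h x by rewrite ffunE valKd.
have extv h : ext h v = h u'.
  by rewrite ffunE /insubd insubF // eqxx.
have extu h : ext h u = h u' by rewrite -[u]/(val u') extV.
have ext_inj : injective ext.
  by move=> g h E; apply/ffunP => x; rewrite -!extV E.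
rewrite -(card_imset _ ext_inj); apply: eq_card => f; rewrite inE.
apply/andP/imsetP => [[/partial_coloringsP Hf /eqP fuv] |
                   [h /partial_coloringsP Hh ->]].
  exists [ffun x => f (val x)].
    apply/partial_coloringsP => x y; rewrite !ffunE => /andP[nxy xy].
    have e_ok (a b : G) : adj a b -> f a = f b ->
        [set a; b] != [set u; v] -> f a = None.
      by move=> ab fab S; apply: (Hf a b) => //; rewrite /= /del_edge_adj ab.
    have nv (z a b : G) : z != v -> z != u -> [set a; z] != [set u; v].
      move=> zv zu; apply/eqP => /setP/(_ z).
      by rewrite !inE eqxx orbT (negPf zv) (negPf zu).
    have nval : val x != val y by rewrite val_eqE.
    case/or3P: xy => [xy | /andP[/eqP xu vy] | /andP[/eqP yu xv]] fxy.
    - apply: (e_ok _ (val y)) => //.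
      apply/eqP => /setP/(_ v); rewrite !inE eqxx orbT.
      by rewrite eq_sym (negPf (valP x)) eq_sym (negPf (valP y)).
    - rewrite xu fuv; apply: (e_ok _ (val y)) => //; first by rewrite -fuv -xu.
      by apply: nv => //; [apply: (valP y) | rewrite -xu eq_sym].
    - apply: (e_ok _ v) => //; first by rewrite -fuv -yu.
      rewrite setUC; apply: nv => //; [exact: (valP x) | by rewrite -yu].
  apply/ffunP => x; rewrite ffunE; case: (eqVneq x v) => [-> | nxv].
    by rewrite ffunE /insubd insubF ?eqxx //= fuv.
  by rewrite ffunE insubdK.
split; last by rewrite extu extv.
apply/partial_coloringsP => x y /andP[xy Sxy].
have nxy := adj_neq xy.
case: (eqVneq x v) Sxy nxy xy => [-> | nxv].
  rewrite setUC; case: (eqVneq y u) => [-> | nyu _ nvy vy]; first by rewrite eqxx.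
  have nyv : y != v by rewrite eq_sym.
  rewrite extv -[y]/(val (exist _ y nyv : contract u v)) extV.
  apply: Hh; rewrite /= /contract_adj -val_eqE /= eq_sym nyu eqxx vy /=.
  by rewrite orbT.
case: (eqVneq y v) => [-> | nyv].
  case: (eqVneq x u) => [-> | nxu _ _ xv]; first by rewrite eqxx.
  rewrite extv -[x]/(val (exist _ x nxv : contract u v)) extV.
  by apply: Hh; rewrite /= /contract_adj -val_eqE /= nxu eqxx xv !orbT.
move=> _ nxy xy.
rewrite -[x]/(val (exist _ x nxv : contract u v)).
rewrite -[y]/(val (exist _ y nyv : contract u v)) !extV.
by apply: Hh; rewrite /= /contract_adj -val_eqE /= nxy xy.
Qed.

Lemma card_colorings_del_ends (G : sgraph) (u v : G) (q : nat) : adj u v ->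
  #|[set f in partial_colorings (del_edge u v) q |
       (f u == None) && (f v == None)]| =
  #|partial_colorings (del_ends u v) q|.
Proof.
move=> uv.
pose ext (h : {ffun del_ends u v -> option 'I_q}) : {ffun G -> option 'I_q} :=
  [ffun x => if insub x is Some y then h y else None].
have extV h (x : del_ends u v) : ext h (val x) = h x by rewrite ffunE valK.
have extN h (x : G) : ~~ ((x != u) && (x != v)) -> ext h x = None.
  by move=> nx; rewrite ffunE insubN.
have ext_inj : injective ext.
  by move=> g h E; apply/ffunP => x; rewrite -!extV E.
rewrite -(card_imset _ ext_inj); apply: eq_card => f; rewrite inE.
apply/and3P/imsetP => [[/partial_coloringsP Hf /eqP fu /eqP fv] |
                    [h /partial_coloringsP Hh ->]].
  exists [ffun x => f (val x)].
    apply/partial_coloringsP => x y xy; rewrite !ffunE; apply: Hf.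
    rewrite /= /del_edge_adj [adj _ _]xy /=; apply/eqP => /setP/(_ u).
    have /andP[xu _] := valP x; have /andP[yu _] := valP y.
    by rewrite !inE eqxx eq_sym (negPf xu) eq_sym (negPf yu).
  apply/ffunP => x; rewrite ffunE; case: insubP => [y _ <- | ].
    by rewrite ffunE.
  by rewrite negb_and !negbK => /orP[] /eqP ->.
split; last 2 first.
- by rewrite extN ?eqxx.
- by rewrite extN ?eqxx ?andbF.
apply/partial_coloringsP => x y /andP[xy _].
case: (boolP ((x != u) && (x != v))) => [nx | /extN -> //].
case: (boolP ((y != u) && (y != v))) => [ny | /extN -> //].
rewrite -[x]/(val (exist _ x nx : del_ends u v)).
rewrite -[y]/(val (exist _ y ny : del_ends u v)) !extV.
exact: Hh.
Qed.

Lemma mem_colorings_edge (G : sgraph) (u v : G) (q : nat)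
    (f : {ffun G -> option 'I_q}) : adj u v ->
  (f \in partial_colorings G q) =
  (f \in partial_colorings (del_edge u v) q) &&
  ((f u == f v) ==> (f u == None)).
Proof.
move=> uv; apply/partial_coloringsP/andP => [Hf | [/partial_coloringsP Hf fuv]].
  split; last by apply/implyP => /eqP/(Hf _ _ uv) ->.
  by apply/partial_coloringsP => x y /andP[xy _]; apply: Hf.
move=> x y xy fxy; case: (eqVneq [set x; y] [set u; v]) => S; last first.
  by apply: (Hf x y) => //; rewrite /= /del_edge_adj xy.
have /orP xuv : (x == u) || (x == v) by rewrite -in_set2 -S set21.
have /orP yuv : (y == u) || (y == v) by rewrite -in_set2 -S set22.
have nxy := adj_neq xy.
case: xuv yuv nxy fxy {S xy} => /eqP -> [] /eqP ->; rewrite ?eqxx // => _ E.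
  by move: fuv; rewrite E eqxx /= => /eqP.
by move: fuv; rewrite -E eqxx /= => /eqP.
Qed.

Lemma card_colorings_rec (G : sgraph) (u v : G) (q : nat) : adj u v ->
  (#|partial_colorings (del_edge u v) q| + #|partial_colorings (del_ends u v) q|
   = #|partial_colorings G q| + #|partial_colorings (contract u v) q|)%N.
Proof.
move=> uv; rewrite -card_colorings_contract // -card_colorings_del_ends //.
rewrite -[RHS]cardsUI; congr (_ + _)%N; apply: eq_card => f.
  rewrite in_setU (mem_colorings_edge _ uv) [f \in [set _ in _ | _]]inE.
  by case: (f \in _) => //=; case: (f u == f v) => //=; rewrite orbT.
rewrite in_setI (mem_colorings_edge _ uv) [f \in [set _ in _ | _]]inE
  [f \in [set _ in _ | _]]inE.
case: (f \in _) => //=; case: (eqVneq (f u) (f v)) => [-> | nuv].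
  by rewrite andbb andbT.
by rewrite andbF; apply: contra_neqF nuv => /andP[/eqP -> /eqP ->].
Qed.

Lemma boolean_number_poly (G : sgraph) (b : int) : is_boolean_number G b ->
  exists2 p : {poly int},
    forall q : nat, p.[q%:R] = #|partial_colorings G q|%:R &
    b = (-1) ^+ #|G| * p.[-1].
Proof.
have isolated (H : sgraph) : (forall x y : H, ~~ adj x y) ->
    forall q : nat, (('X + 1) ^+ #|H|).[q%:R] =
                    #|partial_colorings H q|%:R :> int.
  move=> noE q; rewrite horner_exp !hornerE.
  have -> : partial_colorings H q = [set: {ffun H -> option 'I_q}].
    apply/setP => f; rewrite in_setT; apply/partial_coloringsP => x y.
    by rewrite (negPf (noE x y)).
  by rewrite cardsT card_ffun card_option card_ord natrX -natr1.
elim => {G b} [G G0 | G G0 noE |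
  G u v a b c uv _ [p Hp ->] _ [s Hs ->] _ [t Ht ->]].
- exists (('X + 1) ^+ #|G|); last by rewrite G0 !expr0 !hornerE.
  by apply: isolated => x; have := fintype0 x G0.
- exists (('X + 1) ^+ #|G|); first exact: isolated.
  by rewrite horner_exp !hornerE addNr expr0n eqn0Ngt G0 mulr0.
exists (p - s + t) => [q|].
  rewrite !hornerE Hp Hs Ht addrAC -natrD card_colorings_rec // natrD.
  by rewrite addrK.
rewrite !hornerE -(card_contract u v).
have <- : (#|del_ends u v|).+1 = #|contract u v|.
  by apply: succn_inj; rewrite card_del_ends ?card_contract ?adj_neq.
by rewrite !exprS !mulN1r !opprK !mulrDr mulrN mulNr.
Qed.

Lemma boolean_number_iso (G H : sgraph) (f : G -> H) (a b : int) :
  bijective f -> (forall x y, adj (f x) (f y) = adj x y) ->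
  is_boolean_number G a -> is_boolean_number H b -> a = b.
Proof.
move=> [g fK gK] fadj /boolean_number_poly[p Hp ->] /boolean_number_poly[s Hs ->].
rewrite (bij_eq_card (Bijective fK gK)); congr (_ * _.[_]).
have card_eq q : #|partial_colorings G q| = #|partial_colorings H q|.
  pose T (h : {ffun H -> option 'I_q}) := [ffun x => h (f x)].
  have T_inj : injective T.
    move=> h k /ffunP E; apply/ffunP => y.
    by have := E (g y); rewrite !ffunE gK.
  rewrite -(card_imset _ T_inj); apply: eq_card => h.
  apply/idP/imsetP => [/partial_coloringsP Hh | [k /partial_coloringsP Hk ->]].
    exists [ffun y => h (g y)]; last by apply/ffunP => x; rewrite !ffunE fK.
    apply/partial_coloringsP => x y xy; rewrite !ffunE; apply: Hh.
    by rewrite -fadj !gK.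
  apply/partial_coloringsP => x y xy; rewrite !ffunE; apply: Hk.
  by rewrite fadj.
apply/eqP; rewrite -subr_eq0; apply/eqP.
pose rs := [seq q%:R : int | q <- iota 0 (size (p - s))].
apply: (@roots_geq_poly_eq0 _ _ rs).
- apply/allP => _ /mapP[q _ ->].
  by rewrite /root !hornerE Hp Hs card_eq subrr.
- rewrite map_inj_uniq ?iota_uniq // => m n.
  by rewrite !natz => -[].
- by rewrite size_map size_iota.
Qed.

Lemma is_boolean_number_unique (G : sgraph) (a b : int) :
  is_boolean_number G a -> is_boolean_number G b -> a = b.
Proof. by apply: (@boolean_number_iso G G id); first exists id. Qed.

Lemma is_boolean_numberE (G : sgraph) (b : int) :
  is_boolean_number G b <-> boolean_number G = b.
Proof.
have HG := svalP (boolean_number_exists G).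
by split=> [/(is_boolean_number_unique HG) | <-].
Qed.

Lemma boolean_number_empty (G : sgraph) : #|G| = 0%N -> boolean_number G = 1.
Proof. by move=> G0; apply/is_boolean_numberE/BN_empty. Qed.

Lemma boolean_number_isolated (G : sgraph) :
  (0 < #|G|)%N -> (forall x y : G, ~~ adj x y) -> boolean_number G = 0.
Proof. by move=> G0 noE; apply/is_boolean_numberE/BN_isolated. Qed.

Lemma boolean_number_edge (G : sgraph) (u v : G) : adj u v ->
  boolean_number G = boolean_number (del_edge u v)
                   + boolean_number (contract u v)
                   + boolean_number (del_ends u v).
Proof.
by move=> uv; apply/is_boolean_numberE/(BN_edge uv); apply/is_boolean_numberE.
Qed.

(* Rows are numbered from 1. *)
Definition row_len (lam : seq nat) (i : nat) : nat := nth 0%N lam i.-1.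

(* [inl i] is x_(i+1) and [inr j] is y_(j+1). *)
Definition ferrers_adj (lam : seq nat) :
    rel ('I_(size lam) + 'I_(row_len lam 1)) :=
  fun a b =>
    match a, b with
    | inl i, inr j | inr j, inl i => (j.+1 <= row_len lam i.+1)%N
    | _, _ => false
    end.

Lemma ferrers_sym (lam : seq nat) : symmetric (@ferrers_adj lam).
Proof. by case=> i [] j. Qed.

Lemma ferrers_irr (lam : seq nat) : irreflexive (@ferrers_adj lam).
Proof. by case. Qed.

Definition ferrers_graph (lam : seq nat) : sgraph :=
  SGraph (@ferrers_sym lam) (@ferrers_irr lam).

(* The value at i = 0 is a dummy: only i >= 1 is meaningful.  The natural-number
   difference of row lengths is exact for weakly decreasing [lam], and
   [0 ^+ 0 = 1] in MathComp. *)
Fixpoint ferrers_coef (lam : seq nat) (i : nat) (j : int) {struct i} : int :=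
  match i with
  | 0 => 0
  | 1 => if j == 0 then -1 else if j == 1 then 1 else 0
  | k.+1 =>
      let d := (row_len lam k - row_len lam k.+1)%N in
      j * (j - 1) ^+ d * ferrers_coef lam k (j - 1)
      - (j + 1) * j ^+ d * ferrers_coef lam k j
  end.

(* Main.v *)
Require Import Defs.
From mathcomp Require Import all_boot all_order all_algebra.
From mathcomp Require Import ring.

Import GRing.Theory.
Local Open Scope ring_scope.

(** Up to the sign [(-1) ^ #|G|], the boolean number of [G] is the value at
    [q = -1] of the polynomial counting the partial colourings of [G] by [q]
    colours and a blank.  For a Ferrers graph this polynomial can be computed.
    Once the rows are coloured, the columns are independent of each other, and a
    column whose neighbours use [d] colours has [q + 1 - d] possible values; in
    a Ferrers shape the neighbours of a column are an initial segment of the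
    rows ([card_ferrers_colorings]).

    Colour the rows from top to bottom, and account for a column as soon as the
    last of its neighbours is coloured.  The only information to carry along is
    the number [d] of colours used so far: the next row has [d + 1] values that
    keep [d] unchanged (blank, or a colour already used) and [q - d] values that
    increase it by one.  This transfer process is [row_weight], and [sum_rows]
    says that it computes the count.

    The recursion of [row_weight] makes sense at any [q] in any commutative
    ring.  At [q = 'X] it gives the counting polynomial; at [q = -1] its
    coefficients [d + 1], [q - d] and [q + 1 - d] become [d + 1], [- (d + 1)]
    and [- d], so it turns into the recursion of [ferrers_coef] up to a sign
    that grows by one factor [-1] per row and one per column
    ([row_weight_N1]).  There are [#|G|] such factors in all, and they cancel
    the sign above. *)

(** * The transfer recursion *)

(** For [x = q], this is the number of colourings of the rows [1..i] that use
    exactly [j] colours, each counted with the number of ways to colour the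
    columns that end strictly before row [i]. *)
Fixpoint row_weight {R : comNzRingType} (x : R) (lam : seq nat) (i j : nat) :
    R :=
  match i with
  | 0 => (j == 0%N)%:R
  | k.+1 =>
      let d := (row_len lam k - row_len lam k.+1)%N in
      j.+1%:R * (x + 1 - j%:R) ^+ d * row_weight x lam k j +
      (if j is l.+1 then (x - l%:R) * (x + 1 - l%:R) ^+ d * row_weight x lam k l
       else 0)
  end.

Lemma row_weight_out (R : comNzRingType) (x : R) (lam : seq nat) (i j : nat) :
  (i < j)%N -> row_weight x lam i j = 0.
Proof.
elim: i j => [|i IH] [|j] //= ij.
by rewrite !IH ?mulr0 ?addr0 // ltnW.
Qed.

Lemma row_weight_horner (R : comNzRingType) (a : R) (lam : seq nat)
    (i j : nat) :
  (row_weight 'X lam i j).[a] = row_weight a lam i j.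
Proof.
elim: i j => [|i IH] [|j]; rewrite /= -?polyC_natr ?hornerC //;
  by rewrite -?[_%:R]polyC_natr !(hornerE, horner_exp, IH).
Qed.

(** The recursion read from the side of the state before row [i + 1], which is
    how an added row is counted: a state [j] either stays or moves to [j + 1]. *)
Lemma row_weight_step (R : comNzRingType) (x : R) (lam : seq nat) (i : nat)
    (H : nat -> R) :
  \sum_(0 <= j < i.+2) row_weight x lam i.+1 j * H j =
  \sum_(0 <= j < i.+1) row_weight x lam i j *
    ((x + 1 - j%:R) ^+ (row_len lam i - row_len lam i.+1) *
     (j.+1%:R * H j + (x - j%:R) * H j.+1)).
Proof.
set d := (_ - _)%N.
under eq_bigr => j _ do rewrite /= -/d mulrDl.
rewrite big_split /= big_nat_recr //= row_weight_out // mulr0 mul0r addr0.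
rewrite [X in _ + X]big_nat_recl //= mul0r add0r -big_split /=.
by apply: eq_bigr => j _; ring.
Qed.

(** * Rows and columns of a Ferrers shape *)

Lemma lt_nth_count (s : seq nat) (m k : nat) : sorted geq s ->
  (m < nth 0 s k)%N = (k < count (fun l => m < l) s)%N.
Proof.
elim: s k => [|l s IH] k //=; first by rewrite nth_nil ltn0.
move=> ls; have [ml | lm] := ltnP m l.
  by case: k => [|k] //=; rewrite IH // (path_sorted ls).
have /allP s_le : all (geq l) s.
  by apply: order_path_min ls; apply/rev_trans/leq_trans.
suff c0 : count (fun l => (m < l)%N) s = 0%N.
  case: k => [|k] /=; first by rewrite c0 ltnNge lm.
  by rewrite IH ?(path_sorted ls) // c0.
apply/eqP; rewrite -leqn0 leqNgt -has_count; apply/hasPn => x /s_le /= xl.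
by rewrite -leqNgt (leq_trans xl).
Qed.

(** Columns are numbered from 0 here, as in [ferrers_graph]. *)
Definition col_len (lam : seq nat) (m : nat) : nat :=
  count (fun l => m < l)%N lam.

(** Conjugation of the shape: the neighbours of column [m] are the first
    [col_len lam m] rows. *)
Lemma lt_row_len (lam : seq nat) (m k : nat) : sorted geq lam ->
  (m < row_len lam k.+1)%N = (k < col_len lam m)%N.
Proof. exact: lt_nth_count. Qed.

Lemma row_lenS (lam : seq nat) (i : nat) : sorted geq lam ->
  (row_len lam i.+1 <= row_len lam i)%N.
Proof.
move=> lam_decr; case: i => [//|i].
rewrite leqNgt lt_row_len // -leqNgt.
have [//|/ltnW] := leqP (col_len lam _) i.+1.
by rewrite -lt_row_len // ltnn.
Qed.

Lemma row_len_le1 (lam : seq nat) (i : nat) : sorted geq lam ->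
  (row_len lam i <= row_len lam 1)%N.
Proof.
by move=> lam_decr; elim: i => // i; apply/leq_trans/row_lenS.
Qed.

(** * Specialization at -1 *)

(** At [x = -1] the recursions differ by one factor [-1] for the new row and
    one for each of the columns that end just before it, whence the exponent. *)
Lemma row_weight_N1 (lam : seq nat) (i j : nat) : sorted geq lam ->
  row_weight (-1) lam i.+1 j =
  (-1) ^+ (i.+1 + (row_len lam 1 - row_len lam i.+1)) *
    ferrers_coef lam i.+1 j%:Z :> int.
Proof.
move=> lam_decr; elim: i j => [|i IH] j.
  rewrite subnn addn0 expr1 /= subnn expr0.
  by case: j => [|[|j]] //=; rewrite !mulr0 addr0.
have -> : (row_len lam 1 - row_len lam i.+2 =
  (row_len lam 1 - row_len lam i.+1) + (row_len lam i.+1 - row_len lam i.+2))%N.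
  by rewrite addnBA ?row_lenS // subnK // row_len_le1.
(* One step of each recursion is unfolded by hand, so that the previous stage
   stays folded and can be abstracted. *)
have -> k : ferrers_coef lam i.+2 k =
  let d := (row_len lam i.+1 - row_len lam i.+2)%N in
      k * (k - 1) ^+ d * ferrers_coef lam i.+1 (k - 1)
      - (k + 1) * k ^+ d * ferrers_coef lam i.+1 k by [].
have -> k : row_weight (-1) lam i.+2 k =
  let d := (row_len lam i.+1 - row_len lam i.+2)%N in
      k.+1%:R * (-1 + 1 - k%:R) ^+ d * row_weight (-1) lam i.+1 k +
      (if k is l.+1 then
         (-1 - l%:R) * (-1 + 1 - l%:R) ^+ d * row_weight (-1) lam i.+1 l
       else 0) :> int by [].
move: (row_weight _ lam i.+1) (ferrers_coef lam i.+1) IH => w c.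
move: (row_len lam 1 - _)%N (_ - row_len lam i.+2)%N => e d IH.
rewrite /= !IH !addSn !exprS !exprD.
have opX (x : int) : (-1 + 1 - x) ^+ d = (-1) ^+ d * x ^+ d.
  by rewrite addNr sub0r [LHS]exprNn.
rewrite !opX; case: j => [|j].
  by rewrite mul0r add0r addr0 !mulr1n; ring.
have jS (k : nat) : k.+1%:Z = k%:Z + 1 by rewrite -addn1 PoszD.
rewrite opX IH !natz [j.+2%:Z]jS.
have -> : j.+1%:Z - 1 = j by rewrite jS addrK.
rewrite jS addSn exprS exprD.
ring.
Qed.

(** * Counting colours *)

(** The set is kept inside [option C] so that its complement is directly the
    set of values allowed to a vertex adjacent to all of [s]. *)
Definition colors {C : finType} (s : seq (option C)) : {set option C} :=
  [set c in s | c != None].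

Lemma card_colorsC (R : nzRingType) (C : finType) (s : seq (option C)) :
  #|~: colors s|%:R = #|C|%:R + 1 - #|colors s|%:R :> R.
Proof.
have := cardsC (colors s); rewrite card_option => E.
by rewrite natr1 -E natrD addrAC subrr add0r.
Qed.

(** Blank and the colours of [s] leave the number of colours unchanged; any
    other value increases it by one. *)
Lemma sum_colors_rcons (R : nzRingType) (C : finType) (s : seq (option C))
    (H : nat -> R) :
  \sum_(c : option C) H #|colors (rcons s c)| =
  #|colors s|.+1%:R * H #|colors s| +
  (#|C|%:R - #|colors s|%:R) * H #|colors s|.+1.
Proof.
have nN : None \notin colors s by rewrite inE eqxx andbF.
have cardN : #|None |: colors s| = #|colors s|.+1 by rewrite cardsU1 nN.
rewrite (bigID (mem (None |: colors s))) /=; congr (_ + _).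
  rewrite (eq_bigr (fun=> H #|colors s|)) => [|c cs].
    by rewrite sumr_const cardN mulr_natl.
  congr (H #|pred_of_set _|); apply/setP => y.
  rewrite /colors !inE mem_rcons inE; case: eqVneq => // ->.
  by move: cs; rewrite !inE; case: (c \in s); case: (c == None).
rewrite (eq_bigr (fun=> H #|colors s|.+1)) => [|c cs].
  rewrite (eq_bigl (fun c => c \in ~: (None |: colors s))) => [|c]; last first.
    by rewrite in_setC.
  rewrite sumr_const -[LHS]mulr_natl; congr (_ * _).
  have := cardsC (None |: colors s); rewrite cardN card_option addSn => -[<-].
  by rewrite natrD addrAC subrr add0r.
move: cs; rewrite in_setU1 negb_or => /andP[cN cs].
suff -> : colors (rcons s c) = c |: colors s by rewrite cardsU1 cs.
apply/setP => y.
by rewrite /colors !inE mem_rcons inE; case: eqVneq => // ->; rewrite cN.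
Qed.

Lemma big_tuple_rcons (R : nmodType) (T : finType) (n : nat) (F : seq T -> R) :
  \sum_(t : n.+1.-tuple T) F t =
  \sum_(t : n.-tuple T) \sum_(x : T) F (rcons t x).
Proof.
rewrite pair_bigA.
rewrite (reindex (fun p : n.-tuple T * T => [tuple of rcons p.1 p.2])) //=.
apply/onW_bij/inj_card_bij; last by rewrite card_prod !card_tuple expnSr.
move=> [t x] [u y] /(congr1 val) /= /rcons_inj[tu ->].
by congr (_, _); apply: val_inj.
Qed.

(** The columns from [row_len lam i] on are those that end strictly before row
    [i].  The test function [H] is arbitrary because adding a row replaces it by
    another one. *)
Lemma sum_rows (R : comNzRingType) (C : finType) (lam : seq nat) (i : nat)
    (H : nat -> R) :
  sorted geq lam ->
  \sum_(t : i.-tuple (option C))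
     (\prod_(row_len lam i <= m < row_len lam 1)
        (#|C|%:R + 1 - #|colors (take (col_len lam m) t)|%:R)) * H #|colors t| =
  \sum_(0 <= j < i.+1) row_weight #|C|%:R lam i j * H j.
Proof.
move=> lam_decr; elim: i H => [|i IH] H.
  (* No column is counted yet: row_len lam 0 is the length of the first row. *)
  rewrite big_nat1 mul1r (bigD1 [tuple]) //= [X in _ + X]big1 => [|t]; last first.
    by rewrite (tuple0 t) => /eqP[].
  rewrite addr0 big_geq // mul1r; congr (H _).
  by apply: eq_card0 => c; rewrite inE.
rewrite row_weight_step -IH (big_tuple_rcons _ _ _ (fun s =>
  (\prod_(row_len lam i.+1 <= m < row_len lam 1)
     (#|C|%:R + 1 - #|colors (take (col_len lam m) s)|%:R)) * H #|colors s|)).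
apply: eq_bigr => t _.
rewrite -sum_colors_rcons !mulr_sumr; apply: eq_bigr => c _; rewrite mulrA.
congr (_ * _).
(* The columns before row_len lam i are those that end at row i; all of the
   rows coloured before the new one are their neighbours. *)
rewrite (@big_cat_nat _ _ _ (row_len lam i)) ?row_lenS ?row_len_le1 //= mulrC.
congr (_ * _).
  apply: eq_big_nat => m /andP[im _]; rewrite -cats1 takel_cat // size_tuple.
  by rewrite leqNgt -lt_row_len // -leqNgt (leq_trans (row_lenS _ i lam_decr)).
rewrite big_nat_cond (eq_bigr (fun=> #|C|%:R + 1 - #|colors t|%:R)) => [|m].
  by rewrite -big_nat_cond prodr_const_nat.
rewrite andbT => /andP[im mi].
suff -> : col_len lam m = i by rewrite -cats1 take_size_cat ?size_tuple.
apply/eqP; rewrite eqn_leq; apply/andP; split.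
  by rewrite leqNgt -lt_row_len // -leqNgt.
by case: (i) mi => // k mi; rewrite -lt_row_len.
Qed.

(** * The counting polynomial of a Ferrers graph *)

(** A colouring of the rows constrains each column separately, so the colourings
    extending it are counted by a product over the columns. *)
Lemma card_ferrers_colorings (lam : seq nat) (q : nat) : sorted geq lam ->
  #|partial_colorings (ferrers_graph lam) q|%:R =
  \sum_(t : (size lam).-tuple (option 'I_q))
     \prod_(0 <= m < row_len lam 1)
        (q%:R + 1 - #|colors (take (col_len lam m) t)|%:R) :> int.
Proof.
move=> lam_decr; pose X : finType := option 'I_q.
pose glue (p : (size lam).-tuple X * {ffun 'I_(row_len lam 1) -> X}) :
    {ffun ferrers_graph lam -> X} :=
  [ffun v => match v with inl k => tnth p.1 k | inr m => p.2 m end].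
have glueE t g : (glue (t, g) \in partial_colorings (ferrers_graph lam) q) =
    [forall m : 'I_(row_len lam 1), g m \in ~: colors (take (col_len lam m) t)].
  have mem_take m (c : X) : reflect
      (exists2 k : 'I_(size lam), (m < row_len lam k.+1)%N & tnth t k = c)
      (c \in take (col_len lam m) t).
    have sz_take : size (take (col_len lam m) t) = col_len lam m.
      by rewrite size_takel // size_tuple count_size.
    apply: (iffP idP) => [/(nthP None)[k] | [k mk <-]]; rewrite ?sz_take.
      move=> kc; have ks : (k < size lam)%N.
        by apply: leq_trans kc (count_size _ _).
      rewrite nth_take // => <-.
      exists (Ordinal ks); first by rewrite lt_row_len.
      exact: tnth_nth.
    move: mk; rewrite lt_row_len // => kc.
    by rewrite (tnth_nth None) -(nth_take _ kc) mem_nth ?sz_take.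
  apply/partial_coloringsP/forallP => [col m | free].
    rewrite !inE negb_and negbK; case: (eqVneq (g m) None); first by rewrite orbT.
    rewrite orbF => gm; apply/mem_take => -[k mk tk].
    have := col (inr m) (inl k) mk.
    by rewrite !ffunE /= tk => /(_ erefl) /eqP; apply/negP.
  have side (m : 'I_(row_len lam 1)) (k : 'I_(size lam)) :
      (m < row_len lam k.+1)%N -> tnth t k = g m -> g m = None.
    move=> mk tk; have := free m; rewrite !inE negb_and negbK => /orP[|/eqP //].
    by case/mem_take; exists k.
  case=> [k|m] [k'|m'] //= xy; rewrite !ffunE /= => E.
    by rewrite E; apply: side E.
  by apply: side xy _.
have glue_inj : injective glue.
  move=> [t g] [u h] /ffunP E; congr (_, _).
    by apply: eq_from_tnth => k; have := E (inl k); rewrite !ffunE.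
  by apply/ffunP => m; have := E (inr m); rewrite !ffunE.
have glue_bij : bijective glue.
  apply: inj_card_bij => //.
  by rewrite card_prod !card_ffun card_tuple card_sum expnD !card_ord.
pose allowed (t : (size lam).-tuple X) (m : 'I_(row_len lam 1)) (c : X) : int :=
  (c \in ~: colors (take (col_len lam m) t))%:R.
rewrite -sum1_card natr_sum (reindex glue) /=; last exact: onW_bij.
rewrite big_mkcond (eq_bigr (fun p : _ * {ffun _ -> X} =>
  \prod_m allowed p.1 m (p.2 m))) => [|[t g] _]; last first.
  rewrite glueE /allowed; case: forallP => [free | /forallP].
    by rewrite big1 // => m _; rewrite free.
  rewrite negb_forall => /existsP[m /negPf gm].
  by rewrite (bigD1 m) //= gm mul0r.
rewrite -(pair_bigA _ (fun t (g : {ffun _ -> X}) => \prod_m allowed t m (g m))) /=.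
apply: eq_bigr => t _; rewrite -(bigA_distr_bigA (allowed t)) big_mkord.
apply: eq_bigr => m _.
have := card_colorsC int _ (take (col_len lam m) t); rewrite card_ord => <-.
rewrite -sum1_card natr_sum [RHS]big_mkcond.
by apply: eq_bigr => c _; rewrite /allowed; case: (c \in _).
Qed.

(** The last columns, which reach row [size lam], see all the colours used. *)
Lemma card_ferrers_row_weight (lam : seq nat) (q : nat) :
  (0 < size lam)%N -> sorted geq lam ->
  #|partial_colorings (ferrers_graph lam) q|%:R =
  \sum_(0 <= j < (size lam).+1) row_weight q%:R lam (size lam) j *
     (q%:R + 1 - j%:R) ^+ row_len lam (size lam) :> int.
Proof.
move=> lam_gt0 lam_decr; rewrite card_ferrers_colorings //.
set e := row_len lam (size lam).
have := @sum_rows int 'I_q lam (size lam)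
  (fun d => (q%:R + 1 - d%:R) ^+ e) lam_decr.
rewrite card_ord => <-; apply: eq_bigr => t _.
rewrite (@big_cat_nat _ _ _ e) ?row_len_le1 //= mulrC; congr (_ * _).
rewrite big_nat_cond (eq_bigr (fun=> q%:R + 1 - #|colors t|%:R)) => [|m].
  by rewrite -big_nat_cond prodr_const_nat subn0.
rewrite andbT => /andP[_ me]; rewrite take_oversize // size_tuple.
by move: lam_gt0 me; rewrite /e; case: (size lam) => // k _; rewrite lt_row_len.
Qed.

Lemma poly_eq_on_nat (R : numDomainType) (p s : {poly R}) :
  (forall q : nat, p.[q%:R] = s.[q%:R]) -> p = s.
Proof.
move=> ps; apply/eqP; rewrite -subr_eq0; apply/eqP.
pose rs := [seq q%:R : R | q <- iota 0 (size (p - s))].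
apply: (@roots_geq_poly_eq0 _ _ rs).
- by apply/allP => _ /mapP[q _ ->]; rewrite /root !hornerE ps subrr.
- rewrite map_inj_uniq ?iota_uniq // => m n /eqP.
  by rewrite Num.Theory.eqr_nat => /eqP.
- by rewrite size_map size_iota.
Qed.

Theorem theorem4p3 (r : nat) (lam : r.-tuple nat)
    (r_ge1 : (1 <= r)%N) (lam_decr : sorted geq lam) :
  boolean_number (ferrers_graph lam) =
  \sum_(0 <= j < r.+1)
     ferrers_coef lam r j%:Z * j%:Z ^+ row_len lam r.
Proof.
case: lam lam_decr => lam /= /eqP def_r lam_decr; subst r.
set G := ferrers_graph lam.
rewrite /boolean_number.
have [p p_count ->] := boolean_number_poly (svalP (boolean_number_exists G)).
pose e := row_len lam (size lam).
(* The counts at all natural numbers determine the polynomial, so that it can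
   be evaluated at -1. *)
have -> : p = \sum_(0 <= j < (size lam).+1)
    row_weight 'X lam (size lam) j * ('X + 1 - j%:R) ^+ e.
  apply: poly_eq_on_nat => q; rewrite p_count card_ferrers_row_weight //.
  rewrite horner_sum; apply: eq_bigr => j _.
  by rewrite !(hornerE, horner_exp) row_weight_horner -!polyC_natr !hornerC.
have -> : #|G| = (size lam + row_len lam 1)%N by rewrite card_sum !card_ord.
rewrite horner_sum mulr_sumr; apply: eq_bigr => j _.
have -> : (row_weight 'X lam (size lam) j * ('X + 1 - j%:R) ^+ e).[-1] =
    row_weight (-1) lam (size lam) j * ((-1) ^+ e * j%:Z ^+ e).
  rewrite hornerM row_weight_horner horner_exp; congr (_ * _).
  suff -> : ('X + 1 - j%:R : {poly int}).[-1] = - j%:Z by rewrite [LHS]exprNn.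
  by rewrite !hornerE -polyC_natr hornerC natz.
have -> : row_weight (-1) lam (size lam) j =
    (-1) ^+ (size lam + (row_len lam 1 - e)) * ferrers_coef lam (size lam) j%:Z.
  by rewrite /e; case: (size lam) r_ge1 => // k _; apply: row_weight_N1.
set n := size lam; set m := row_len lam 1.
(* The sign of the boolean number and the sign picked up by the recursion both
   have exponent n + m, so they cancel. *)
transitivity ((-1) ^+ (n + m) * (-1) ^+ (n + (m - e) + e) *
    (ferrers_coef lam n j%:Z * j%:Z ^+ e)); first by rewrite !exprD; ring.
by rewrite -addnA subnK ?row_len_le1 // -expr2 sqrr_sign mul1r.
Qed.
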